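(* Let $q$ be a prime power, $n$ a positive integer, and let $a,b,c\in\mathbb{F}_q$ with $a+b+c=0$ and $c\neq 0$. Let $A\subseteq\mathbb{F}_q^n$ be a subset such that every solution $(a_1,a_2,a_3)\in A^3$ of $a\,a_1+b\,a_2+c\,a_3=0$ satisfies $a_1=a_2=a_3$. Let $f(x)=\frac{1+x+x^2+\cdots+x^{q-1}}{x^{(q-1)/3}}$ and let $r$ be a real number with $0<r<1$ at which $f$ attains its minimum on the positive real axis. Then, as $n\to\infty$, \[ |A|\le \frac{3}{(1-r)r}\sqrt{\frac{f(r)}{f''(r)}}\,\frac{f(r)^n}{\sqrt{2\pi n}}\,(1+o(1)) . \] In particular $|A|=O\!\left(\frac{\theta_q^n}{\sqrt{n}}\right)$ where $\theta_q=f(r)$.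
   Context: Here $o(1)$ denotes a quantity (independent of $A$) tending to $0$ as $n\to\infty$ with $q$ fixed. *)

(* Defs.v *)
From HB Require Import structures.
From mathcomp Require Export all_boot all_order all_algebra.
From mathcomp Require Export all_classical all_reals all_analysis.
Export Order.TTheory GRing.Theory Num.Theory.
Export numFieldNormedType.Exports.

Set Implicit Arguments.
Unset Strict Implicit.
Unset Printing Implicit Defensive.

Local Open Scope ring_scope.

Definition prime_power (q : nat) : Prop :=
  exists p k : nat, [/\ prime p, (0 < k)%N & q = (p ^ k)%N].

(* The exponent (q - 1) / 3 is a real number, hence the real power powR;
   only the values at x > 0 are meaningful. *)
Definition fq (R : realType) (q : nat) (x : R) : R :=
  (\sum_(i < q) x ^+ i) / (x `^ ((q%:R - 1) / 3)).

Definition only_trivial_solutions (F : finFieldType) (n : nat) (a b c : F)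
    (A : {set 'rV[F]_n}) : Prop :=
  forall a1 a2 a3 : 'rV[F]_n, a1 \in A -> a2 \in A -> a3 \in A ->
    a *: a1 + b *: a2 + c *: a3 = 0 -> a1 = a2 /\ a2 = a3.

(* Main.v *)
Require Import Defs.
From mathcomp Require Import all_boot all_order all_algebra.
From mathcomp Require Import all_classical all_reals all_analysis.
From mathcomp Require Import finfield zify ring lra complex.

(* On A x A x A the indicator of a x + b y + c z = 0, which is the product over
   the coordinates of 1 - (a x_i + b y_i + c z_i)^(q-1), is the diagonal tensor.
   Each of its monomials has degree at most (q-1)n/3 in one of x, y, z, so its
   slice rank is at most 3N, where N counts the e in {0..q-1}^n with sum at most
   (q-1)n/3; the slice rank of a diagonal tensor is |A|, hence |A| <= 3N.

   N is the sum of the coefficients of degree m <= sn of G^n, where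
   G = 1 + X + ... + X^(q-1) and s = (q-1)/3. Put p = G(rX)/G(r), the generating
   function of a law on {0..q-1}: the m-th coefficient of G^n is
   G(r)^n r^(-m) [X^m]p^n. Since r is a critical point of f(x) = G(x) x^(-s),
   the law has mean s and variance sigma^2 = r^2 f''(r)/f(r). By Fourier
   inversion [X^m]p^n is at most (1/2pi) times the integral of |p(e^(it))|^n;
   comparing |p(e^(it))| with a Gaussian near 0 and with a constant < 1
   elsewhere gives [X^m]p^n <= (1+o(1))/(sigma sqrt(2 pi n)), and the geometric
   sum of the r^(-m) contributes the factor r^(-sn)/(1-r). *)

Set Implicit Arguments.
Unset Strict Implicit.
Unset Printing Implicit Defensive.
Local Open Scope ring_scope.

(** * Slice rank *)

Lemma mxrank_mxsub (F : fieldType) (m n m' n' : nat) (f : 'I_m' -> 'I_m)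
  (g : 'I_n' -> 'I_n) (A : 'M[F]_(m, n)) : (\rank (mxsub f g A) <= \rank A)%N.
Proof.
have -> : mxsub f g A = rowsub f (1%:M) *m A *m colsub g (1%:M).
  by rewrite -rowsubE mulmx_colsub mulmx1; apply/matrixP => i j; rewrite !mxE.
by apply: leq_trans (mxrankM_maxl _ _) _; apply: mxrankM_maxr.
Qed.

Lemma card_support_le_rank_diag (F : fieldType) (n : nat) (v : 'rV[F]_n) :
  (#|support (v 0%R)| <= \rank (diag_mx v))%N.
Proof.
pose S := support (v 0); pose g (k : 'I_#|S|) : 'I_n := enum_val k.
apply: leq_trans (mxrank_mxsub g g (diag_mx v)).
have -> : mxsub g g (diag_mx v) = diag_mx (colsub g v).
  by apply/matrixP => i j; rewrite !mxE (inj_eq enum_val_inj).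
suff /mxrank_unit -> : diag_mx (colsub g v) \in unitmx by [].
rewrite unitmxE det_diag unitfE; apply/prodf_neq0 => k _.
by have := enum_valP k; rewrite inE mxE.
Qed.

Lemma exists_support_ge_rank (F : fieldType) (m n : nat) (W : 'M[F]_(m, n)) :
  exists2 v : 'rV[F]_n, (v <= W)%MS & (\rank W <= #|support (v 0%R)|)%N.
Proof.
pose B := row_base W.
have fB : row_full B^T by rewrite /row_full mxrank_tr; exact: row_base_free.
pose g := fullrankfun fB.
have uB : colsub g B \in unitmx.
  by rewrite -unitmx_tr trmx_mxsub; apply: fullrowsub_unit.
pose v : 'rV[F]_n := const_mx 1 *m invmx (colsub g B) *m B.
have vg j : v 0 (g j) = 1.
  transitivity (colsub g v (0 : 'I_1) j); first by rewrite [RHS]mxE.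
  by rewrite -mulmx_colsub mulmxKV // mxE.
exists v; first by rewrite -(eq_row_base W) submxMl.
rewrite -[leqLHS]card_ord -(card_imset _ (@fullrankfun_inj _ _ _ _ fB)).
apply/subset_leq_card/fintype.subsetP => _ /imsetP[j _ ->].
by rewrite inE vg oner_neq0.
Qed.

Definition slice_sum (R : nzRingType) (T : Type) (k1 k2 k3 : nat)
    (f1 : 'I_k1 -> T -> R) (g1 : 'I_k1 -> T -> T -> R)
    (f2 : 'I_k2 -> T -> R) (g2 : 'I_k2 -> T -> T -> R)
    (f3 : 'I_k3 -> T -> R) (g3 : 'I_k3 -> T -> T -> R) (x y z : T) : R :=
  \sum_m f1 m x * g1 m y z + \sum_m f2 m y * g2 m x z
    + \sum_m f3 m z * g3 m x y.

Definition slice_rank_le (R : nzRingType) (T : Type) (k : nat)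
    (t : T -> T -> T -> R) : Prop :=
  exists k1 k2 k3 f1 g1 f2 g2 f3 g3, (k1 + k2 + k3 <= k)%N /\
    forall x y z, t x y z = @slice_sum R T k1 k2 k3 f1 g1 f2 g2 f3 g3 x y z.

Definition contraction (R : nzRingType) (N : nat)
    (t : 'I_N -> 'I_N -> 'I_N -> R) (v : 'rV[R]_N) : 'M[R]_N :=
  \matrix_(x, y) \sum_z v 0 z * t x y z.

Lemma rank_contraction_le (F : fieldType) (N k1 k2 k3 : nat)
    (f1 : 'I_k1 -> 'I_N -> F) (g1 : 'I_k1 -> 'I_N -> 'I_N -> F)
    (f2 : 'I_k2 -> 'I_N -> F) (g2 : 'I_k2 -> 'I_N -> 'I_N -> F)
    (f3 : 'I_k3 -> 'I_N -> F) (g3 : 'I_k3 -> 'I_N -> 'I_N -> F) (v : 'rV[F]_N) :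
  v *m \matrix_(z, m) f3 m z = 0 ->
  (\rank (contraction (slice_sum f1 g1 f2 g2 f3 g3) v) <= k1 + k2)%N.
Proof.
move=> vf3.
have vf m : \sum_z v 0 z * f3 m z = 0.
  have /matrixP/(_ 0 m) := vf3; rewrite !mxE => vf3m; rewrite -[RHS]vf3m.
  by apply: eq_bigr => z _; rewrite mxE.
have -> : contraction (slice_sum f1 g1 f2 g2 f3 g3) v =
    (\matrix_(x, m) f1 m x) *m (\matrix_(m, y) \sum_z v 0 z * g1 m y z)
    + (\matrix_(x, m) \sum_z v 0 z * g2 m x z) *m (\matrix_(m, y) f2 m y).
  apply/matrixP => x y; rewrite !mxE.
  under eq_bigr => z _ do rewrite /slice_sum !mulrDr !mulr_sumr.
  rewrite !big_split /= [X in _ + X](_ : _ = 0) ?addr0.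
    congr (_ + _); rewrite exchange_big; apply: eq_bigr => m _; rewrite !mxE.
      by rewrite mulr_sumr; apply: eq_bigr => z _; rewrite mulrCA.
    by rewrite mulr_suml; apply: eq_bigr => z _; rewrite mulrA mulrAC.
  rewrite exchange_big big1 // => m _.
  by under eq_bigr => z _ do rewrite mulrA; rewrite -mulr_suml vf mul0r.
by apply: leq_trans (mxrank_add _ _) (leq_add _ _); exact: mulmx_max_rank.
Qed.

(* Tao's lemma: contract the tensor with a vector of large support which kills
   the slices in the third variable. *)
Lemma slice_rank_diagonal_ge (F : fieldType) (N k : nat)
    (t : 'I_N -> 'I_N -> 'I_N -> F) :
  (forall x y z, (t x y z != 0) = (x == y) && (y == z)) ->
  slice_rank_le k t -> (N <= k)%N.
Proof.
move=> t_diag [k1 [k2 [k3 [f1 [g1 [f2 [g2 [f3 [g3 [lek tE]]]]]]]]]].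
pose C : 'M[F]_(N, k3) := \matrix_(z, m) f3 m z.
have [v /sub_kermxP vC le_supp] := exists_support_ge_rank (kermx C).
have := rank_contraction_le f1 g1 f2 g2 g3 vC.
have -> : contraction (slice_sum f1 g1 f2 g2 f3 g3) v =
    diag_mx (\row_x (v 0 x * t x x x)).
  apply/matrixP => x y; rewrite !mxE; under eq_bigr => z _ do rewrite -tE.
  rewrite (bigD1 x) //= big1 => [|z nzx].
    have [<-|nxy] := eqVneq x y; first by rewrite addr0.
    have /eqP -> : t x y x == 0 by rewrite -[_ == _]negbK t_diag (negPf nxy).
    by rewrite mulr0 addr0.
  have /eqP -> : t x y z == 0; last by rewrite mulr0.
  by rewrite -[_ == _]negbK t_diag; case: eqP => //= <-; rewrite eq_sym.
move/(leq_trans (card_support_le_rank_diag _)).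
rewrite (eq_card (B := support (v 0))) => [|x]; last first.
  by rewrite !inE mxE mulf_eq0 negb_or t_diag !eqxx /= andbT.
move/(leq_trans le_supp); rewrite mxrank_ker.
have := rank_leq_col C; lia.
Qed.

Lemma slice_rank_le_expansion (R : comNzRingType) (T : Type) (E X : finType)
    (M : {set X}) (coeff : E -> R) (f : X -> T -> R) (ex ey ez : E -> X)
    (t : T -> T -> T -> R) :
  (forall x y z,
     t x y z = \sum_e coeff e * f (ex e) x * f (ey e) y * f (ez e) z) ->
  (forall e, [|| ex e \in M, ey e \in M | ez e \in M]) ->
  slice_rank_le (3 * #|M|) t.
Proof.
move=> tE inM.
have slicesE (P : pred E) (p : E -> X) (h : E -> R) x :
    (forall e, P e -> p e \in M) -> \sum_(e | P e) f (p e) x * h e =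
    \sum_(k < #|M|) f (enum_val k) x *
      \sum_(e | P e && (p e == enum_val k)) h e.
  move=> PM; rewrite (partition_big p (mem M)) //= big_enum_val /=.
  apply: eq_bigr => k _; rewrite mulr_sumr.
  by apply: eq_bigr => e /andP[_ /eqP ->].
pose inx e := ex e \in M.
pose iny e := (ex e \notin M) && (ey e \in M).
pose inz e := (ex e \notin M) && (ey e \notin M).
exists #|M|, #|M|, #|M|.
exists (fun k => f (enum_val k)), (fun k y z =>
  \sum_(e | inx e && (ex e == enum_val k)) coeff e * f (ey e) y * f (ez e) z).
exists (fun k => f (enum_val k)), (fun k x z =>
  \sum_(e | iny e && (ey e == enum_val k)) coeff e * f (ex e) x * f (ez e) z).
exists (fun k => f (enum_val k)), (fun k x y =>
  \sum_(e | inz e && (ez e == enum_val k)) coeff e * f (ex e) x * f (ey e) y).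
split=> [|x y z]; first lia.
rewrite /slice_sum -(slicesE inx ex) // -(slicesE iny ey) => [|e /andP[] //].
rewrite -(slicesE inz ez) => [|e /andP[/negPf exM /negPf eyM]]; last first.
  by have := inM e; rewrite exM eyM.
rewrite tE (bigID inx) -addrA /=; congr (_ + _).
  by apply: eq_bigr => e _; ring.
rewrite (bigID (fun e => ey e \in M)) /=; congr (_ + _);
  by apply: eq_bigr => e _; ring.
Qed.

(** * Polynomial expansion of the indicator of the solution set *)

Lemma expr3D (R : comNzRingType) (x y z : R) (d : nat) :
  (x + y + z) ^+ d = \sum_(e : {i : 'I_d.+1 & 'I_i.+1})
    (x ^+ (d - tag e) * y ^+ (tag e - tagged e) * z ^+ tagged e)
      *+ ('C(d, tag e) * 'C(tag e, tagged e)).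
Proof.
rewrite -addrA exprDn.
transitivity (\sum_(i < d.+1) \sum_(j < i.+1)
    (x ^+ (d - i) * y ^+ (i - j) * z ^+ j) *+ ('C(d, i) * 'C(i, j))).
  apply: eq_bigr => i _; rewrite exprDn mulr_sumr -sumrMnl.
  by apply: eq_bigr => j _; rewrite mulrnAr mulrA -mulrnA mulnC.
exact: (sig_big_dep xpredT (fun _ => xpredT)).
Qed.

Lemma finField_indicator (F : finFieldType) (x : F) :
  1 - x ^+ #|F|.-1 = (x == 0)%:R.
Proof.
have F_gt1 := card_finNzRing_gt1 F.
have [->|x0] := eqVneq x 0; first by rewrite expr0n gtn_eqF ?subr0 ?ltn_predRL.
suff -> : x ^+ #|F|.-1 = 1 by rewrite subrr.
by apply: (mulfI x0); rewrite -exprS prednK ?expf_card ?mulr1 // ltnW.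
Qed.

Lemma linear_form_indicator (F : finFieldType) (a b c : F) :
  exists (E : finType) (coeff : E -> F) (ex ey ez : E -> 'I_#|F|),
    (forall e, ex e + ey e + ez e <= #|F|.-1)%N /\
    forall x y z, (a * x + b * y + c * z == 0)%:R =
      \sum_e coeff e * x ^+ ex e * y ^+ ey e * z ^+ ez e.
Proof.
set d := #|F|.-1.
have F_gt0 : (0 < #|F|)%N := ltnW (card_finNzRing_gt1 F).
have expo_lt k : (k <= d)%N -> (k < #|F|)%N by rewrite /d; lia.
pose expo k : 'I_#|F| := insubd (Ordinal F_gt0) k.
have expoE k : (k <= d)%N -> expo k = k :> nat.
  by move=> /expo_lt lt_k; rewrite val_insubd lt_k.
pose E : finType := {i : 'I_d.+1 & 'I_i.+1}.
have tag_le (e : E) : (tag e <= d)%N by rewrite -ltnS.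
have tagged_le (e : E) : (tagged e <= tag e)%N by rewrite -ltnS.
have sub_le (e : E) : (tag e - tagged e <= d)%N.
  exact: leq_trans (leq_subr _ _) (tag_le e).
have tagged_le_d (e : E) := leq_trans (tagged_le e) (tag_le e).
(* The summand unit indexes the monomial 1 of 1 - (a x + b y + c z) ^+ d. *)
exists (unit + E)%type.
exists (fun s : unit + E => if s is inr e then
  - (a ^+ (d - tag e) * b ^+ (tag e - tagged e) * c ^+ tagged e
     *+ ('C(d, tag e) * 'C(tag e, tagged e))) else 1).
exists (fun s : unit + E => if s is inr e then expo (d - tag e)%N else expo 0).
exists (fun s : unit + E =>
  if s is inr e then expo (tag e - tagged e)%N else expo 0).
exists (fun s : unit + E => if s is inr e then expo (tagged e) else expo 0).
split=> [[[]|e]|x y z].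
- by rewrite !expoE.
- by rewrite !expoE ?leq_subr // -addnA !subnK.
rewrite -finField_indicator expr3D big_sumType /=; congr (_ + _).
  by rewrite (big_pred1 tt) => [|[]//]; rewrite !expoE // !expr0 !mulr1.
rewrite -sumrN; apply: eq_bigr => e _.
rewrite !expoE ?leq_subr //.
by rewrite !exprMn !mulNr !mulrnAl; congr (- (_ *+ _)); ring.
Qed.

Definition monomial (F : comNzRingType) (n q : nat) (m : {ffun 'I_n -> 'I_q})
    (x : 'rV[F]_n) : F := \prod_i x 0 i ^+ m i.

Definition low_degree (n q : nat) : {set {ffun 'I_n -> 'I_q}} :=
  [set m : {ffun 'I_n -> 'I_q} | 3 * \sum_i m i <= q.-1 * n]%N.

Lemma low_degree_pigeonhole (n q : nat) (m1 m2 m3 : {ffun 'I_n -> 'I_q}) :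
  (forall i, m1 i + m2 i + m3 i <= q.-1)%N ->
  [|| m1 \in low_degree n q, m2 \in low_degree n q | m3 \in low_degree n q].
Proof.
move=> deg_le.
have : (\sum_i m1 i + \sum_i m2 i + \sum_i m3 i <= q.-1 * n)%N.
  rewrite -!big_split -[n in (_ * n)%N]card_ord mulnC -sum_nat_const /=.
  exact: leq_sum.
rewrite !inE; lia.
Qed.

Lemma solution_indicator (F : finFieldType) (n : nat) (a b c : F) :
  exists (E : finType) (coeff : E -> F)
         (ex ey ez : E -> {ffun 'I_n -> 'I_#|F|}),
    (forall e, [|| ex e \in low_degree n #|F|, ey e \in low_degree n #|F|
                 | ez e \in low_degree n #|F|]) /\
    forall x y z : 'rV[F]_n, (a *: x + b *: y + c *: z == 0)%:R =
      \sum_e coeff e * monomial (ex e) x * monomial (ey e) y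
                * monomial (ez e) z.
Proof.
have [E [coeff [ex [ey [ez [degE sumE]]]]]] := linear_form_indicator a b c.
pose vec (p : E -> 'I_#|F|) (e : {ffun 'I_n -> E}) := [ffun i => p (e i)].
exists {ffun 'I_n -> E}, (fun e : {ffun 'I_n -> E} => \prod_i coeff (e i)).
exists (vec ex), (vec ey), (vec ez); split=> [e|x y z].
  by apply: low_degree_pigeonhole => i; rewrite !ffunE degE.
transitivity (\prod_i (a * x 0 i + b * y 0 i + c * z 0 i == 0)%:R : F).
  have [/rowP sol0|] := eqVneq (a *: x + b *: y + c *: z) 0.
    by rewrite big1 // => i _; have := sol0 i; rewrite !mxE => ->; rewrite eqxx.
  by move/rV0Pn=> [j]; rewrite !mxE (bigD1 j) //= => /negPf ->; rewrite mul0r.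
under eq_bigr => i _ do rewrite sumE.
rewrite bigA_distr_bigA; apply: eq_bigr => e _.
by rewrite /monomial -!big_split /=; apply: eq_bigr => i _; rewrite !ffunE.
Qed.

Lemma card_le_low_degree (F : finFieldType) (n : nat) (a b c : F)
    (A : {set 'rV[F]_n}) :
  a + b + c = 0 -> only_trivial_solutions a b c A ->
  (#|A| <= 3 * #|low_degree n #|F| |)%N.
Proof.
move=> abc0 trivA.
have [E [coeff [ex [ey [ez [lowE indE]]]]]] := solution_indicator n a b c.
pose t (i j l : 'I_#|A|) : F :=
  (a *: enum_val i + b *: enum_val j + c *: enum_val l == 0)%:R.
apply: (@slice_rank_diagonal_ge F _ _ t) => [i j l|].
  have -> : (i == j) && (j == l) =
      (a *: enum_val i + b *: enum_val j + c *: enum_val l == 0).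
    apply/andP/eqP => [[/eqP -> /eqP ->]|sol].
      by rewrite -!scalerDl abc0 scale0r.
    have [/enum_val_inj -> /enum_val_inj ->] :=
      trivA _ _ _ (enum_valP i) (enum_valP j) (enum_valP l) sol.
    by [].
  by rewrite /t; case: (_ + _ == 0); rewrite ?oner_neq0 ?eqxx.
apply: (slice_rank_le_expansion (coeff := coeff) (T := 'I_#|A|)
  (f := fun m i => monomial m (enum_val i)) _ lowE).
by move=> i j l; exact: indE.
Qed.

(** * Polynomials on the unit circle *)

Local Open Scope classical_set_scope.
Local Open Scope ring_scope.
Local Notation mu := lebesgue_measure.

Definition expi (R : realType) (t : R) : R[i] := (cos t +i* sin t)%C.

Lemma expiD (R : realType) (s t : R) : expi (s + t) = expi s * expi t.
Proof.
by rewrite /expi cosD sinD; apply/eqP; rewrite eq_complex /= !eqxx addrC /=.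
Qed.

Lemma expiX (R : realType) (t : R) (k : nat) : expi t ^+ k = expi (k%:R * t).
Proof.
elim: k => [|k IH]; first by rewrite mul0r /expi cos0 sin0.
by rewrite exprSr IH -expiD -natr1 mulrDl mul1r.
Qed.

Lemma normc_expi (R : realType) (t : R) : Normc.normc (expi t) = 1.
Proof. by rewrite /= cos2Dsin2 sqrtr1. Qed.

Lemma normr_Re_le_normc (R : rcfType) (z : R[i]) :
  `|complex.Re z| <= Normc.normc z.
Proof. by rewrite -lecR; exact: normc_ge_Re. Qed.

Lemma normcX (R : rcfType) (z : R[i]) (n : nat) :
  Normc.normc (z ^+ n) = Normc.normc z ^+ n.
Proof.
elim: n => [|n IH]; first exact: Normc.normc1.
by rewrite !exprS Normc.normcM IH.
Qed.

Definition circle_norm (R : realType) (p : {poly R}) (t : R) : R :=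
  Normc.normc (map_poly (real_complex R) p).[expi t].

Lemma horner_expi (R : realType) (p : {poly R}) (s t : R) :
  (map_poly (real_complex R) p).[expi t] * expi s =
  ((\sum_(k < size p) p`_k * cos (k%:R * t + s)) +i*
   (\sum_(k < size p) p`_k * sin (k%:R * t + s)))%C.
Proof.
rewrite horner_coef size_map_poly mulr_suml.
apply/eqP; rewrite eq_complex !raddf_sum /=.
by apply/andP; split; apply/eqP/eq_bigr => k _;
  rewrite coef_map expiX -mulrA -expiD /= mul0r ?subr0 ?addr0.
Qed.

Lemma circle_normX (R : realType) (p : {poly R}) (n : nat) (t : R) :
  circle_norm (p ^+ n) t = circle_norm p t ^+ n.
Proof. by rewrite /circle_norm rmorphXn horner_exp normcX. Qed.

Lemma circle_norm_ge0 (R : realType) (p : {poly R}) (t : R) :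
  0 <= circle_norm p t.
Proof. by rewrite /circle_norm; case: _.[_] => x y; exact: sqrtr_ge0. Qed.

Lemma circle_normE (R : realType) (p : {poly R}) (t : R) :
  circle_norm p t = Num.sqrt ((\sum_(k < size p) p`_k * cos (k%:R * t)) ^+ 2
    + (\sum_(k < size p) p`_k * sin (k%:R * t)) ^+ 2).
Proof.
have := horner_expi p 0 t.
rewrite [expi 0]/expi cos0 sin0 mulr1 /circle_norm => -> /=.
by under eq_bigr => k _ do rewrite addr0;
   under [in X in _ + X]eq_bigr => k _ do rewrite addr0.
Qed.

(* |E e^(itX)|^2 = E cos (t (X - X')), where X' is an independent copy of X. *)
Lemma circle_norm_sqr (R : realType) (p : {poly R}) (t : R) :
  circle_norm p t ^+ 2 = p.[1] ^+ 2 - \sum_(j < size p) \sum_(k < size p)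
    p`_j * p`_k * (1 - cos ((j%:R - k%:R) * t)).
Proof.
rewrite circle_normE sqr_sqrtr ?addr_ge0 ?sqr_ge0 // horner_coef.
under [in RHS]eq_bigr => j _ do rewrite expr1n mulr1.
rewrite !expr2 !mulr_suml -sumrB -big_split /=; apply: eq_bigr => j _.
rewrite !mulr_sumr -sumrB -big_split /=; apply: eq_bigr => k _.
by rewrite mulrBl cosB; ring.
Qed.

Lemma continuous_sumr (T : topologicalType) (K : numFieldType)
    (V : normedModType K) (I : Type) (s : seq I) (f : I -> T -> V) :
  (forall i, continuous (f i)) -> continuous (fun t => \sum_(i <- s) f i t).
Proof.
move=> fc; elim: s => [|i s IH] t.
  by under eq_fun => x do rewrite big_nil; apply: cvg_cst.
under eq_fun => x do rewrite big_cons.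
by apply: cvgD; [exact: fc|exact: IH].
Qed.

Lemma continuous_dilation (R : realType) (g : R -> R) (a b : R) :
  continuous g -> continuous (fun t => b * g (a * t)).
Proof.
move=> gc t; apply: cvgM; first exact: cvg_cst.
exact: (continuous_comp (@mulrl_continuous _ _ _) (gc _)).
Qed.

Lemma continuous_circle_norm (R : realType) (p : {poly R}) :
  continuous (circle_norm p).
Proof.
rewrite (funext (circle_normE p)) => t.
apply: (@continuous_comp _ _ _ (fun t => _ + _) _ _ _ (@sqrt_continuous R _)).
by apply: cvgD; apply: (@continuous_comp _ _ _ (fun t => \sum_k _) _ _ _
    (@exprn_continuous R 2 _));
  apply: continuous_sumr => k; apply: continuous_dilation;
  [exact: continuous_cos|exact: continuous_sin].
Qed.

Lemma continuous_integrable_itv (R : realType) (f : R -> R) (a b : R) :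
  continuous f -> mu.-integrable `[a, b] (EFin \o f).
Proof.
move=> fc; apply: continuous_compact_integrable; first exact: segment_compact.
exact: continuous_subspaceT.
Qed.

Lemma Rintegral_sum_continuous (R : realType) (I : Type) (s : seq I)
    (f : I -> R -> R) (a b : R) : (forall i, continuous (f i)) ->
  \int[mu]_(t in `[a, b]) (\sum_(i <- s) f i t) =
  \sum_(i <- s) \int[mu]_(t in `[a, b]) f i t.
Proof.
move=> fc; elim: s => [|i s IH].
  under eq_Rintegral => t _ do rewrite big_nil.
  by rewrite big_nil Rintegral_cst ?mul0r.
under eq_Rintegral => t _ do rewrite big_cons.
rewrite big_cons -IH RintegralD //; apply: continuous_integrable_itv => //.
exact: continuous_sumr.
Qed.

Lemma sin_natpi (R : realType) (k : nat) : sin (k%:R * pi) = 0 :> R.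
Proof.
elim: k => [|k IH]; first by rewrite mul0r sin0.
by rewrite -natr1 mulrDl mul1r sinDpi IH oppr0.
Qed.

Lemma Rintegral_cos_sub (R : realType) (s m : nat) :
  \int[mu]_(t in `[- pi, pi]) cos ((s%:R - m%:R) * t) =
  (2 * pi) *+ (s == m) :> R.
Proof.
have pi0 := pi_gt0 R.
have [->|nsm] := eqVneq s m.
  rewrite subrr; under eq_Rintegral => t _ do rewrite mul0r cos0.
  rewrite Rintegral_cst //= lebesgue_measure_itv /= lte_fin ifT /=; last lra.
  by rewrite mul1r; lra.
set a : R := s%:R - m%:R.
have a0 : a != 0 by rewrite subr_eq0 eqr_nat.
pose F : R -> R := a^-1 \*: (@sin R \o (a \*: @idfun R)).
have dF (t : R) : is_derive t (1 : R) F (cos (a * t)).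
  apply: is_derive_eq; rewrite /=.
  by rewrite -![_ *: _]/(_ * _) mulr1 mulrCA mulVf ?mulr1.
rewrite /Rintegral (@continuous_FTC2 _ _ F) /=.
- have sa : sin (a * pi) = 0.
    by rewrite mulrBl sinB !sin_natpi mul0r mulr0 subrr.
  rewrite /F /= -![_ *: _]/(_ * _) /=.
  by rewrite mulrN sinN sa oppr0 mulr0 subrr mulr0n.
- lra.
- apply: continuous_subspaceT => t.
  exact: (continuous_comp (@mulrl_continuous _ _ _) (@continuous_cos R _)).
- have cF (t : R) : F x @[x --> t] --> F t.
    by apply/differentiable_continuous/derivable1_diffP; case: (dF t).
  split; first by move=> t _; case: (dF t).
    exact/cvg_at_right_filter/cF.
  exact/cvg_at_left_filter/cF.
- by move=> t _; rewrite derive1E; case: (dF t).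
Qed.

Lemma coef_Rintegral (R : realType) (p : {poly R}) (m : nat) :
  2 * pi * p`_m = \int[mu]_(t in `[- pi, pi])
    \sum_(k < size p) p`_k * cos ((k%:R - m%:R) * t).
Proof.
rewrite Rintegral_sum_continuous => [|k]; last first.
  exact/continuous_dilation/continuous_cos.
under eq_bigr => k _.
  rewrite RintegralZl ?Rintegral_cos_sub //=; last first.
    apply: continuous_integrable_itv => t.
    exact: (continuous_comp (@mulrl_continuous _ _ _) (@continuous_cos R _)).
  rewrite mulrnAr mulrb; over.
rewrite -big_mkcond /= (big_ord1_eq _ (fun k => p`_k * (2 * pi))).
by case: ltnP => [_|/(nth_default 0) ->]; rewrite ?mulr0 // mulrC.
Qed.

Lemma coef_le_circle_norm (R : realType) (p : {poly R}) (m : nat) :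
  2 * pi * `|p`_m| <= \int[mu]_(t in `[- pi, pi]) circle_norm p t.
Proof.
have trig_cont : continuous (fun t : R =>
    \sum_(k < size p) p`_k * cos ((k%:R - m%:R) * t)).
  by apply: continuous_sumr => k; exact/continuous_dilation/continuous_cos.
rewrite -[2 * pi]ger0_norm ?mulr_ge0 ?pi_ge0 // -normrM coef_Rintegral.
apply: le_trans (le_normr_Rintegral _ _) _ => //.
  exact: continuous_integrable_itv.
apply: le_Rintegral => //.
- apply: continuous_integrable_itv => t.
  by apply: continuous_comp; [exact: trig_cont|exact: norm_continuous].
- exact/continuous_integrable_itv/continuous_circle_norm.
move=> t _; rewrite /circle_norm.
have -> : \sum_(k < size p) p`_k * cos ((k%:R - m%:R) * t) = complex.Re
    ((map_poly (real_complex R) p).[expi t] * expi (- (m%:R * t))).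
  by rewrite horner_expi /=; apply: eq_bigr => k _; rewrite mulrBl.
apply: le_trans (normr_Re_le_normc _) _.
by rewrite Normc.normcM normc_expi mulr1.
Qed.

(** * Local limit upper bound *)

Lemma sin_mean_value (R : realType) (y : R) : 0 < y ->
  exists2 c : R, 0 < c < y & sin y = cos c * y.
Proof.
move=> y0.
have [c + E] := MVT y0 (fun x _ => is_derive_sin x)
  (continuous_subspaceT (@continuous_sin R)).
rewrite in_itv /= => ?; exists c => //.
by move: E; rewrite sin0 !subr0.
Qed.

Lemma sqr_sin_le (R : realType) (y : R) : sin y ^+ 2 <= y ^+ 2.
Proof.
wlog y0 : y / 0 < y.
  move=> wlog_gt0; have [/wlog_gt0//|y0|<-] := ltgtP 0 y; last by rewrite sin0.
  by rewrite -sqrrN -sinN -[y ^+ 2]sqrrN wlog_gt0 // oppr_gt0.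
have [c _ ->] := sin_mean_value y0.
rewrite exprMn cos2sin2.
have := sqr_ge0 (sin c); have := sqr_ge0 y; nra.
Qed.

Lemma sqr_sin_ge (R : realType) (y : R) : y ^+ 2 * (1 - y ^+ 2) <= sin y ^+ 2.
Proof.
wlog y0 : y / 0 < y.
  move=> wlog_gt0; have [/wlog_gt0//|y0|<-] := ltgtP 0 y; last first.
    by rewrite sin0 expr0n mul0r.
  by rewrite -[sin y ^+ 2]sqrrN -sinN -[y ^+ 2]sqrrN wlog_gt0 // oppr_gt0.
have [c /andP[c0 cy] ->] := sin_mean_value y0.
rewrite exprMn cos2sin2 mulrC ler_wpM2r ?sqr_ge0 // lerD2l lerN2.
apply: le_trans (sqr_sin_le c) _.
by rewrite ler_pXn2r ?nnegrE ?ltW // (lt_trans c0).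
Qed.

Lemma oneBcosE (R : realType) (x : R) : 1 - cos x = 2 * sin (x / 2) ^+ 2.
Proof.
have -> : cos x = cos ((x / 2) *+ 2) by congr cos; rewrite mulr2n; lra.
by rewrite cos_mulr2n cos2sin2 mulr2n; lra.
Qed.

Lemma oneBcos_ge (R : realType) (x : R) :
  x ^+ 2 / 2 * (1 - (x / 2) ^+ 2) <= 1 - cos x.
Proof.
rewrite oneBcosE.
have -> : x ^+ 2 / 2 * (1 - (x / 2) ^+ 2) =
    2 * ((x / 2) ^+ 2 * (1 - (x / 2) ^+ 2)) by field.
by rewrite ler_wpM2l // sqr_sin_ge.
Qed.

Lemma Rintegral_gauss_le (R : realType) (a b c : R) : 0 < c ->
  \int[mu]_(t in `[a, b]) expR (- (c * t ^+ 2)) <= Num.sqrt (pi / c).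
Proof.
move=> c0; pose s := Num.sqrt (2 * c)^-1.
have c20 : 0 < (2 * c)^-1 by rewrite invr_gt0; lra.
have s0 : s != 0 by rewrite gt_eqF // sqrtr_gt0.
have s2 : s ^+ 2 = (2 * c)^-1 by rewrite sqr_sqrtr // ltW.
have peak0 := normal_peak_gt0 s0.
have peakE : (normal_peak s)^-1 = Num.sqrt (pi / c).
  rewrite /normal_peak invrK s2; congr Num.sqrt.
  by rewrite -mulr_natl; field; rewrite gt_eqF.
have -> : (fun t => expR (- (c * t ^+ 2))) =
    (fun t => Num.sqrt (pi / c) * normal_pdf 0 s t).
  apply/funext => t; rewrite normal_pdfE // -peakE.
  rewrite -[RHS]/((normal_peak s)^-1 * (normal_peak s * normal_fun 0 s t)).
  rewrite mulrA mulVf ?gt_eqF // mul1r.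
  rewrite /normal_fun s2 subr0; congr expR.
  by rewrite -mulr_natl; field; rewrite gt_eqF.
have pdf_integrable : mu.-integrable `[a, b] (EFin \o normal_pdf 0 s).
  by apply: integrableS (@integrable_normal_pdf R 0 s).
rewrite RintegralZl // ler_piMr ?sqrtr_ge0 //.
rewrite -lee_fin fineK; last exact: integrable_fin_num.
rewrite -(@integral_normal_pdf R 0 s); apply: ge0_subset_integral => //=.
  by apply/measurable_realfun.measurable_EFinP; exact: measurable_normal_pdf.
by move=> t _; rewrite lee_fin normal_pdf_ge0.
Qed.

Lemma ler_term_sum2 (R : numDomainType) (I J : finType) (f : I -> J -> R)
    (i0 : I) (j0 : J) :
  (forall i j, 0 <= f i j) -> f i0 j0 <= \sum_i \sum_j f i j.
Proof.
move=> f0; rewrite (bigD1 i0) //= (bigD1 j0) //= -addrA lerDl addr_ge0 //.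
  by apply: sumr_ge0.
by apply: sumr_ge0 => i _; apply: sumr_ge0.
Qed.

Lemma sqrtr_natr_le (R : rcfType) (n : nat) : Num.sqrt n%:R <= n%:R :> R.
Proof.
rewrite -[leRHS]ger0_norm // -sqrtr_sqr ler_wsqrtr // expr2 -natrM ler_nat.
by case: n => // n; exact: leq_pmulr.
Qed.

Lemma cvg_sqrtn_geometric (R : realType) (rho : R) : 0 < rho < 1 ->
  Num.sqrt n%:R * rho ^+ n @[n --> \oo] --> (0 : R).
Proof.
move=> /andP[rho0 rho1]; pose y := - ln rho / 2.
have y0 : 0 < y by rewrite divr_gt0 // oppr_gt0 ln_lt0 // rho0.
have rhoE n : rho ^+ n = expR (- (n%:R * y)) * expR (- y) ^+ n.
  rewrite -expRM_natl -expRD -[in LHS](lnK rho0) -expRM_natl.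
  by congr expR; rewrite /y; field.
apply: (@squeeze_cvgr _ _ _ _ (cst 0) (fun n => y^-1 * expR (- y) ^+ n)).
- near=> n; rewrite mulr_ge0 ?sqrtr_ge0 ?exprn_ge0 ?(ltW rho0) //=.
  rewrite rhoE mulrA ler_wpM2r ?exprn_ge0 ?expR_ge0 //.
  rewrite expRN -ler_pdivlMr ?invr_gt0 ?expR_gt0 // invrK mulrC.
  rewrite -ler_pdivrMr ?invr_gt0 // invrK.
  apply: le_trans (expR_ge1Dx _); apply: le_trans (_ : n%:R * y <= _); last lra.
  by rewrite ler_wpM2r ?(ltW y0) // sqrtr_natr_le.
- exact: cvg_cst.
- by apply: cvg_geometric; rewrite ger0_norm ?expR_ge0 // expR_lt1 oppr_lt0.
Unshelve. all: by end_near. Qed.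

Lemma coef_Xderiv (R : nzRingType) (p : {poly R}) (k : nat) :
  ('X * p^`())`_k = k%:R * p`_k.
Proof.
by rewrite coefXM coef_deriv; case: k => [|k]; rewrite ?mul0r // mulr_natl.
Qed.

Lemma size_Xderiv_le (R : nzRingType) (p : {poly R}) :
  (size ('X * p^`())%R <= size p)%N.
Proof.
by apply/leq_sizeP => k le_k; rewrite coef_Xderiv nth_default ?mulr0.
Qed.

Lemma sum_natM_coef (R : comNzRingType) (p : {poly R}) (n : nat) :
  (size p <= n)%N -> \sum_(k < n) k%:R * p`_k = p^`().[1].
Proof.
move=> size_p.
have sizeXp := leq_trans (size_Xderiv_le p) size_p.
have -> : p^`().[1] = ('X * p^`()).[1] by rewrite hornerM hornerX mul1r.
rewrite (horner_coef_wide _ sizeXp); apply: eq_bigr => k _.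
by rewrite coef_Xderiv expr1n mulr1.
Qed.

Lemma sum_natM2_coef (R : comNzRingType) (p : {poly R}) :
  \sum_(k < size p) k%:R ^+ 2 * p`_k = p^`()^`().[1] + p^`().[1].
Proof.
transitivity (('X * p^`())^`().[1]); last first.
  by rewrite derivM derivX mul1r !hornerE addrC.
rewrite -(sum_natM_coef (size_Xderiv_le p)).
by apply: eq_bigr => k _; rewrite coef_Xderiv mulrA.
Qed.

(* p^`()^`().[1] is the second factorial moment of the law generated by p. *)
Definition pgf_variance (R : comNzRingType) (p : {poly R}) : R :=
  p^`()^`().[1] + p^`().[1] - p^`().[1] ^+ 2.

Lemma pgf_varianceE (R : numFieldType) (p : {poly R}) : p.[1] = 1 ->
  pgf_variance p = \sum_(j < size p) \sum_(k < size p)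
    p`_j * p`_k * ((j%:R - k%:R) ^+ 2 / 2).
Proof.
move=> p1; rewrite /pgf_variance -sum_natM2_coef -!(sum_natM_coef (leqnn _)).
set S2 := \sum_k _ ^+ 2 * _; set S1 := \sum_k _.
have S0 : \sum_(k < size p) p`_k = 1.
  by rewrite -p1 horner_coef; apply: eq_bigr => k _; rewrite expr1n mulr1.
transitivity (\sum_(j < size p) (2^-1 * (j%:R ^+ 2 * p`_j)
    - S1 * (j%:R * p`_j) + S2 / 2 * p`_j)).
  by rewrite !big_split sumrN -!mulr_sumr /= S0 -/S1 -/S2; field.
apply: eq_bigr => j _.
transitivity (\sum_(k < size p) (p`_j * j%:R ^+ 2 / 2 * p`_k
    - p`_j * j%:R * (k%:R * p`_k) + p`_j / 2 * (k%:R ^+ 2 * p`_k))).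
  by rewrite !big_split sumrN -!mulr_sumr /= S0 -/S1 -/S2; field.
by apply: eq_bigr => k _; field.
Qed.

Section local_limit.
Variables (R : realType) (p : {poly R}).
Hypotheses (p_ge0 : forall k, 0 <= p`_k) (p_total : p.[1] = 1).
Hypotheses (p0_gt0 : 0 < p`_0) (p1_gt0 : 0 < p`_1).

Local Notation s2 := (pgf_variance p).

Let pp_ge0 j k : 0 <= p`_j * p`_k.
Proof. exact: mulr_ge0. Qed.

Let size_gt1 : (1 < size p)%N.
Proof.
by rewrite ltnNge; apply: contraL p1_gt0 => ?; rewrite nth_default ?ltxx.
Qed.

Let term01_le (f : nat -> nat -> R) : (forall j k, 0 <= f j k) ->
  f 0 1 <= \sum_(j < size p) \sum_(k < size p) f j k.
Proof.
move=> f0; exact: (@ler_term_sum2 _ _ _ (fun j k : 'I_(size p) => f j k)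
  (Ordinal (ltnW size_gt1)) (Ordinal size_gt1)).
Qed.

Lemma pgf_variance_gt0 : 0 < s2.
Proof.
rewrite pgf_varianceE //.
apply: lt_le_trans (term01_le (f := fun j k =>
  p`_j * p`_k * ((j%:R - k%:R) ^+ 2 / 2)) _) => [|j k].
  by rewrite sub0r sqrrN expr1n !mulr_gt0.
by rewrite mulr_ge0 ?pp_ge0 // divr_ge0 ?sqr_ge0.
Qed.

Lemma circle_norm_sqr_le (t : R) : circle_norm p t ^+ 2 <=
  1 - s2 * t ^+ 2 * (1 - ((size p)%:R * t / 2) ^+ 2).
Proof.
rewrite circle_norm_sqr p_total expr1n lerD2l lerN2 pgf_varianceE // -mulrA.
rewrite mulr_suml; apply: ler_sum => j _; rewrite mulr_suml.
apply: ler_sum => k _; rewrite -[leLHS]mulrA ler_wpM2l ?pp_ge0 //.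
apply: le_trans (oneBcos_ge _).
rewrite (_ : _ / 2 * _ = ((j%:R - k%:R) * t) ^+ 2 / 2
  * (1 - ((size p)%:R * t / 2) ^+ 2)); last by field.
rewrite ler_wpM2l ?divr_ge0 ?sqr_ge0 // lerD2l lerN2 !exprMn.
rewrite !ler_wpM2r ?sqr_ge0 // -[leLHS]real_normK ?num_real //.
rewrite lerXn2r ?nnegrE // ler_distl.
have size_ge (i : 'I_(size p)) : i%:R <= (size p)%:R :> R.
  by rewrite ler_nat ltnW.
have := size_ge j; have := size_ge k.
have : 0 <= j%:R :> R by []; have : 0 <= k%:R :> R by [].
by move=> *; apply/andP; split; lra.
Qed.

Lemma circle_norm_sqr_far (d t : R) : 0 <= d -> d <= `|t| <= pi ->
  circle_norm p t ^+ 2 <= 1 - p`_0 * p`_1 * (1 - cos d).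
Proof.
move=> d0 /andP[dt tpi].
rewrite circle_norm_sqr p_total expr1n lerD2l lerN2.
apply: le_trans (term01_le (f := fun j k =>
  p`_j * p`_k * (1 - cos ((j%:R - k%:R) * t))) _) => [|j k]; last first.
  by rewrite mulr_ge0 ?pp_ge0 // subr_ge0 cos_le1.
rewrite ler_wpM2l ?pp_ge0 // lerD2l lerN2 sub0r mulN1r cosN -cos_norm.
rewrite leNgt ltr_cos ?in_itv /= ?normr_ge0 ?tpi -?leNgt //.
by rewrite d0 (le_trans dt).
Qed.

Lemma circle_norm_gauss (kappa : R) : 1 < kappa ->
  exists2 d, 0 < d <= pi & forall t : R, `|t| <= d ->
    circle_norm p t <= expR (- (s2 / (2 * kappa ^+ 2) * t ^+ 2)).
Proof.
move=> kappa_gt1; have s2_gt0 := pgf_variance_gt0.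
have kappaV_lt1 : kappa ^- 2 < 1.
  by rewrite invf_lt1 ?exprn_egt1 // exprn_gt0 //; lra.
have size0 : 0 < (size p)%:R :> R by rewrite ltr0n ltnW.
pose d : R := Num.min pi (2 * Num.sqrt (1 - kappa ^- 2) / (size p)%:R).
exists d => [|t td].
  rewrite ge_min lexx lt_min pi_gt0 divr_gt0 // mulr_gt0 //.
  by rewrite sqrtr_gt0 subr_gt0.
rewrite -(ler_pXn2r (ltn0Sn 1)) ?nnegrE ?expR_ge0 ?circle_norm_ge0 //.
rewrite -expRM_natl; apply: le_trans (circle_norm_sqr_le t) _.
apply: le_trans (expR_ge1Dx _); rewrite lerD2l.
have -> : 2%:R * - (s2 / (2 * kappa ^+ 2) * t ^+ 2) =
    - (s2 * t ^+ 2 * kappa ^- 2) by field; lra.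
rewrite lerN2 ler_wpM2l //; first by rewrite mulr_ge0 ?sqr_ge0 // ltW.
rewrite lerBrDr addrC -lerBrDr.
have t_le : (size p)%:R * `|t| / 2 <= Num.sqrt (1 - kappa ^- 2).
  by move: td; rewrite le_min => /andP[_]; rewrite ler_pdivlMr //; lra.
have : ((size p)%:R * `|t| / 2) ^+ 2 <= Num.sqrt (1 - kappa ^- 2) ^+ 2.
  by apply: lerXn2r t_le; rewrite nnegrE ?sqrtr_ge0 // !mulr_ge0.
rewrite sqr_sqrtr ?subr_ge0 ?(ltW kappaV_lt1) //.
by rewrite !exprMn real_normK ?num_real.
Qed.

Lemma circle_norm_lt1 (d : R) : 0 < d <= pi ->
  exists2 rho, 0 < rho < 1 & forall t : R, d <= `|t| <= pi ->
    circle_norm p t <= rho.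
Proof.
move=> /andP[d0 dpi].
have cosd : cos d < 1.
  by rewrite -cos0 ltr_cos // in_itv /= ?lexx ?pi_ge0 // (ltW d0).
pose rho2 : R := Num.max (1 / 2) (1 - p`_0 * p`_1 * (1 - cos d)).
have rho2_lt1 : rho2 < 1.
  rewrite gt_max; apply/andP; split; first lra.
  by rewrite ltrBlDr ltrDl !mulr_gt0 // subr_gt0.
have rho2_gt0 : 0 < rho2 by rewrite lt_max divr_gt0.
exists (Num.sqrt rho2) => [|t t_far].
  by rewrite sqrtr_gt0 rho2_gt0 -sqrtr1 ltr_sqrt.
rewrite -(ler_pXn2r (ltn0Sn 1)) ?nnegrE ?sqrtr_ge0 ?circle_norm_ge0 //.
rewrite [leRHS]sqr_sqrtr ?(ltW rho2_gt0) // le_max.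
by rewrite circle_norm_sqr_far ?orbT // ltW.
Qed.

Lemma circle_normX_le (kappa : R) : 1 < kappa ->
  exists2 rho : R, 0 < rho < 1 & forall (n : nat) (t : R), `|t| <= pi ->
    circle_norm (p ^+ n) t <=
    expR (- (n%:R * s2 / (2 * kappa ^+ 2) * t ^+ 2)) + rho ^+ n.
Proof.
move=> kappa_gt1; have [d d_pi near0] := circle_norm_gauss kappa_gt1.
have [rho /andP[rho0 rho1] far] := circle_norm_lt1 d_pi.
exists rho => [|n t tpi]; first by rewrite rho0.
rewrite circle_normX; have [td|dt] := lerP `|t| d.
  rewrite ler_wpDr ?exprn_ge0 ?(ltW rho0) //.
  rewrite (_ : - _ = n%:R * - (s2 / (2 * kappa ^+ 2) * t ^+ 2)); last by ring.
  by rewrite expRM_natl lerXn2r ?nnegrE ?expR_ge0 ?circle_norm_ge0 ?near0.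
rewrite ler_wpDl ?expR_ge0 // lerXn2r ?nnegrE ?circle_norm_ge0 ?(ltW rho0) //.
by rewrite far // (ltW dt).
Qed.

Local Notation circle_integral n :=
  (\int[mu]_(t in `[- pi, pi]) circle_norm (p ^+ n) t).

Lemma circle_integral_le (kappa : R) : 1 < kappa ->
  exists2 rho : R, 0 < rho < 1 & forall n : nat, (0 < n)%N ->
    circle_integral n <=
    kappa * Num.sqrt (2 * pi / (n%:R * s2)) + rho ^+ n * (2 * pi).
Proof.
move=> kappa_gt1; have [rho rho01 norm_le] := circle_normX_le kappa_gt1.
exists rho => // n n0.
have s2_gt0 := pgf_variance_gt0; have pi0 := pi_gt0 R.
have nR : 0 < n%:R :> R by rewrite ltr0n.
have c0 : 0 < n%:R * s2 / (2 * kappa ^+ 2).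
  by rewrite divr_gt0 ?mulr_gt0 ?exprn_gt0 //; lra.
have := norm_le n; move: c0; set c := n%:R * s2 / _ => c0 {}norm_le.
have gauss_cont : continuous (fun t : R => expR (- (c * t ^+ 2))).
  move=> t; apply: (cvg_comp (fun x => - (c * x ^+ 2)) expR); last first.
    exact: continuous_expR.
  apply: (@cvgN _ R^o); apply: cvgM; [exact: cvg_cst|exact: exprn_continuous].
have rho_cont : continuous (fun _ : R => rho ^+ n) by move=> t; exact: cvg_cst.
apply: le_trans (_ : \int[mu]_(t in `[- pi, pi])
    (expR (- (c * t ^+ 2)) + rho ^+ n) <= _).
  apply: le_Rintegral => //.
  - exact/continuous_integrable_itv/continuous_circle_norm.
  - apply: continuous_integrable_itv => t.
    by apply: cvgD; [exact: gauss_cont|exact: rho_cont].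
  - by move=> t /=; rewrite in_itv /= => tpi; apply: norm_le; rewrite ler_norml.
rewrite RintegralD //; try exact: continuous_integrable_itv.
apply: lerD.
  apply: le_trans (Rintegral_gauss_le _ _ c0) _.
  rewrite -[X in _ <= X * _]ger0_norm; last lra.
  rewrite -sqrtr_sqr -sqrtrM ?sqr_ge0 // le_eqVlt; apply: predU1l.
  by congr Num.sqrt; rewrite /c; field; rewrite !gt_eqF //; lra.
rewrite Rintegral_cst //= lebesgue_measure_itv /= lte_fin ifT /=; last lra.
by case/andP: rho01 => rho0 _; rewrite ler_wpM2l ?exprn_ge0 ?(ltW rho0) //; lra.
Qed.

(* Relative excess of the Fourier bound on the coefficients of p ^+ n over the
   peak 1 / sqrt (2 pi n s2) of the limiting Gaussian density. *)
Definition local_excess (n : nat) : R :=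
  Num.max 0 (Num.sqrt (n%:R * s2 / (2 * pi)) * circle_integral n - 1).

Lemma local_excess_ge0 (n : nat) : 0 <= local_excess n.
Proof. by rewrite le_max lexx. Qed.

Lemma local_excess_cvg0 : local_excess n @[n --> \oo] --> (0 : R).
Proof.
have s2_gt0 := pgf_variance_gt0; have pi0 := pi_gt0 R.
apply/cvgrPdist_le => /= e e0.
have kappa_gt1 : 1 < 1 + e / 2 by lra.
have [rho rho01 int_le] := circle_integral_le kappa_gt1.
pose D := Num.sqrt (s2 / (2 * pi)) * (2 * pi).
have D0 : 0 < D by rewrite mulr_gt0 ?sqrtr_gt0 ?divr_gt0 ?mulr_gt0.
near=> n.
have n0 : (0 < n)%N by near: n; exact: nbhs_infty_gt.
have nR : 0 < n%:R :> R by rewrite ltr0n.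
have tail_le : Num.sqrt n%:R * rho ^+ n <= e / 2 / D.
  near: n; apply: (cvgr_le _ (cvg_sqrtn_geometric rho01)).
  by rewrite !divr_gt0.
rewrite sub0r normrN ger0_norm ?local_excess_ge0 //.
rewrite ge_max (ltW e0) /= lerBlDr.
apply: le_trans (ler_wpM2l (sqrtr_ge0 _) (int_le n n0)) _; rewrite mulrDr.
have -> : Num.sqrt (n%:R * s2 / (2 * pi))
    * ((1 + e / 2) * Num.sqrt (2 * pi / (n%:R * s2))) = 1 + e / 2.
  rewrite mulrCA -sqrtrM ?divr_ge0 ?mulr_ge0 ?(ltW s2_gt0) ?(ltW pi0) //.
  rewrite -[X in _ * Num.sqrt (_ * X)]invf_div divff ?sqrtr1 ?mulr1 //.
  by rewrite gt_eqF // divr_gt0 ?mulr_gt0.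
have -> : Num.sqrt (n%:R * s2 / (2 * pi)) * (rho ^+ n * (2 * pi)) =
    Num.sqrt n%:R * rho ^+ n * D.
  by rewrite /D -[n%:R * s2 / _]mulrA sqrtrM ?(ltW nR) //; ring.
by move: tail_le; rewrite ler_pdivlMr //; lra.
Unshelve. all: by end_near. Qed.

Lemma coefX_le_local_excess (n m : nat) : (0 < n)%N ->
  (p ^+ n)`_m <=
  (1 + local_excess n) / (Num.sqrt s2 * Num.sqrt (2 * pi * n%:R)).
Proof.
move=> n0; have s2_gt0 := pgf_variance_gt0; have pi0 := pi_gt0 R.
have nR : 0 < n%:R :> R by rewrite ltr0n.
rewrite ler_pdivlMr; last by rewrite mulr_gt0 // sqrtr_gt0 ?mulr_gt0.
have -> : Num.sqrt s2 * Num.sqrt (2 * pi * n%:R) =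
    Num.sqrt (n%:R * s2 / (2 * pi)) * (2 * pi).
  rewrite -[X in _ = _ * X]ger0_norm; last by rewrite mulr_ge0 ?(ltW pi0).
  rewrite -sqrtr_sqr -!sqrtrM ?divr_ge0 ?mulr_ge0 ?(ltW pi0) ?(ltW s2_gt0) //.
  congr Num.sqrt; move: pi0; move: (pi : R) => c c0.
  by field; rewrite gt_eqF.
apply: le_trans (_ : Num.sqrt (n%:R * s2 / (2 * pi)) * circle_integral n <= _).
  rewrite mulrCA ler_wpM2l ?sqrtr_ge0 // mulrC.
  apply: le_trans (coef_le_circle_norm _ m).
  by rewrite ler_wpM2l ?mulr_ge0 ?(ltW pi0) ?ler_norm.
by rewrite -lerBlDl le_max lexx orbT.
Qed.

End local_limit.

(** * Exponential tilting *)

Lemma coef_comp_polyZX (R : comNzRingType) (p : {poly R}) (r : R) (m : nat) :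
  (p \Po (r *: 'X))`_m = p`_m * r ^+ m.
Proof.
rewrite coef_comp_poly.
under eq_bigr => k _ do
  rewrite exprZn coefZ coefXn mulr_natr mulrnAr eq_sym mulrb.
rewrite -big_mkcond /= (big_ord1_eq _ (fun k => p`_k * r ^+ k)).
by case: ltnP => // /(nth_default 0) ->; rewrite mul0r.
Qed.

Definition tilt (R : fieldType) (G : {poly R}) (r : R) : {poly R} :=
  G.[r]^-1 *: (G \Po (r *: 'X)).

Lemma coef_tiltX (R : fieldType) (G : {poly R}) (r : R) (n m : nat) :
  (tilt G r ^+ n)`_m = (G ^+ n)`_m * r ^+ m / G.[r] ^+ n.
Proof.
by rewrite /tilt exprZn coefZ -rmorphXn /= coef_comp_polyZX exprVn mulrC.
Qed.

Lemma horner_tilt1 (R : fieldType) (G : {poly R}) (r : R) :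
  G.[r] != 0 -> (tilt G r).[1] = 1.
Proof. by move=> G0; rewrite /tilt !hornerE horner_comp !hornerE mulVf. Qed.

Lemma pgf_variance_tilt (R : fieldType) (G : {poly R}) (r : R) :
  pgf_variance (tilt G r) = r ^+ 2 * G^`()^`().[r] / G.[r]
    + r * G^`().[r] / G.[r] - (r * G^`().[r] / G.[r]) ^+ 2.
Proof.
rewrite /pgf_variance /tilt.
rewrite !(derivZ, deriv_comp, derivM, derivX, derivC, alg_polyC, mulr1).
rewrite !hornerE !horner_comp !hornerE /=; ring.
Qed.

Lemma powR_mulB1 (R : realType) (a x : R) : 0 < x ->
  x `^ a = x * x `^ (a - 1).
Proof.
move=> x0; rewrite -[X in X * _](powRr1 (ltW x0)) -powRD.
  by congr (_ `^ _); ring.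
by rewrite (gt_eqF x0) implybT.
Qed.

Lemma sum_exprV_le (R : realFieldType) (r : R) (M : nat) : 0 < r < 1 ->
  \sum_(m < M.+1) r ^- m <= r ^- M / (1 - r).
Proof.
move=> /andP[r0 r1]; have r10 : 0 < 1 - r by rewrite subr_gt0.
elim: M => [|M IH].
  by rewrite big_ord1 expr0 invr1 mul1r invf_ge1 // lerBlDr lerDl ltW.
rewrite big_ord_recr /=; apply: le_trans (lerD IH (lexx _)) _.
rewrite le_eqVlt; apply: predU1l.
have rM : r ^+ M != 0 by rewrite expf_neq0 // gt_eqF.
by rewrite exprS; field; rewrite rM !gt_eqF.
Qed.

Section chernoff.
Variables (R : realType) (G : {poly R}) (s : R).

Definition chernoff_fun (x : R) : R := G.[x] * x `^ (- s).

Local Notation H := ('X * G^`() - s *: G).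

Lemma is_derive_chernoff_fun (x : R) : 0 < x ->
  is_derive x (1 : R) chernoff_fun (H.[x] * x `^ (- s - 1)).
Proof.
move=> x0.
have dG := is_derive_poly G x.
have dpow := is_derive1_powR (- s) x0.
have -> : chernoff_fun = horner G * (@powR R)^~ (- s) by [].
apply: is_derive_eq; rewrite /= -![_ *: _]/(_ * _) !hornerE.
by rewrite (powR_mulB1 (- s) x0) /=; ring.
Qed.

Variable r : R.
Hypothesis r0 : 0 < r.
Hypothesis r_min : forall x, 0 < x -> chernoff_fun r <= chernoff_fun x.

Lemma chernoff_critical : r * G^`().[r] = s * G.[r].
Proof.
have d0 : is_derive r (1 : R) chernoff_fun 0.
  have r1 : 0 <= r + 1 :> R by rewrite addr_ge0 // ltW.
  apply: (derive1_at_min r1) => [t||t].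
  - by rewrite in_itv /= => /andP[t0 _]; case: (is_derive_chernoff_fun t0).
  - by rewrite in_itv /= r0 ltrDl ltr01.
  - by rewrite in_itv /= => /andP[t0 _]; exact: r_min.
have : H.[r] * r `^ (- s - 1) = 0.
  by case: d0 => _ <-; case: (is_derive_chernoff_fun r0) => _ ->.
move/eqP; rewrite mulf_eq0 [_ `^ _ == 0]gt_eqF ?powR_gt0 // orbF.
by rewrite !hornerE subr_eq0 => /eqP.
Qed.

Lemma chernoff_derive2 : derive1n 2 chernoff_fun r =
  (G^`().[r] + r * G^`()^`().[r] - s * G^`().[r]) * r `^ (- s - 1).
Proof.
rewrite derive1nS derive1E.
have dH := is_derive_poly H r.
have dpow := is_derive1_powR (- s - 1) r0.
have deriveE : \near r, horner H r * r `^ (- s - 1)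
    = derive1n 1 chernoff_fun r.
  near=> x; have x0 : 0 < x by near: x; exact: lt_nbhsr.
  by rewrite derive1n1 derive1E; case: (is_derive_chernoff_fun x0) => _ ->.
have := near_eq_is_derive deriveE (is_deriveM dH dpow).
case=> _ -> /=.
have -> : H.[r] = 0 by rewrite !hornerE chernoff_critical subrr.
rewrite scale0r add0r -[LHS]/(_ * _) mulrC.
by rewrite derivB derivM derivX mul1r derivZ !hornerE.
Unshelve. all: by end_near. Qed.

Lemma chernoff_ratio : G.[r] != 0 ->
  chernoff_fun r / derive1n 2 chernoff_fun r =
  r ^+ 2 / pgf_variance (tilt G r).
Proof.
move=> G0; rewrite pgf_variance_tilt chernoff_derive2 /chernoff_fun.
rewrite (powR_mulB1 (- s) r0).
have crit : s = r * G^`().[r] / G.[r] by rewrite chernoff_critical mulfK.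
rewrite -crit; set V := _ - s * _.
have -> : r ^+ 2 * G^`()^`().[r] / G.[r] + s - s ^+ 2 = V * (r / G.[r]).
  by rewrite /V crit; field.
have powr0 : r `^ (- s - 1) != 0 by rewrite gt_eqF // powR_gt0.
have rn0 : r != 0 by rewrite gt_eqF.
rewrite !invfM; move: V^-1 => W; field.
by rewrite G0 rn0.
Qed.

Hypothesis r1 : r < 1.

(* Undoing the tilt multiplies the m-th coefficient by G.[r] ^+ n * r ^- m. As
   r < 1, these factors form a geometric sum dominated by its last term. *)
Lemma sum_coefX_le (n M : nat) (B : R) : 0 < G.[r] -> 0 <= B ->
  M%:R <= s * n%:R -> (forall m, (tilt G r ^+ n)`_m <= B) ->
  \sum_(m < M.+1) (G ^+ n)`_m <= chernoff_fun r ^+ n / (1 - r) * B.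
Proof.
move=> G0 B0 leM tilt_le.
have r10 : 0 < 1 - r by rewrite subr_gt0.
apply: le_trans (_ : \sum_(m < M.+1) G.[r] ^+ n * B * r ^- m <= _).
  apply: ler_sum => m _; rewrite ler_pdivlMr ?exprn_gt0 //.
  by rewrite -ler_pdivrMl ?exprn_gt0 // mulrC -coef_tiltX.
rewrite -mulr_sumr.
apply: le_trans (ler_wpM2l _ (sum_exprV_le _ _)) _.
- by rewrite mulr_ge0 ?exprn_ge0 ?(ltW G0).
- by rewrite r0.
have invX_le : r ^- M <= (r `^ (- s)) ^+ n.
  rewrite powRN exprVn lef_pV2 ?posrE ?exprn_gt0 ?powR_gt0 //.
  rewrite -!powR_mulrn ?(ltW r0) ?powR_ge0 // -powRrM.
  by apply: ger_powR => //; rewrite r0 ltW.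
rewrite [leLHS](_ : _ = G.[r] ^+ n * r ^- M * (B / (1 - r))); last by ring.
rewrite [leRHS](_ : _ = G.[r] ^+ n * (r `^ (- s)) ^+ n * (B / (1 - r))).
  by rewrite ler_wpM2r ?ler_wpM2l ?divr_ge0 ?exprn_ge0 ?(ltW r10) ?(ltW G0).
by rewrite /chernoff_fun exprMn; ring.
Qed.

Hypothesis G_ge0 : forall k, 0 <= G`_k.
Hypotheses (G0_gt0 : 0 < G`_0) (G1_gt0 : 0 < G`_1).

Let Gr_gt0 : 0 < G.[r].
Proof.
have size0 : (0 < size G)%N.
  rewrite lt0n; apply: contraTneq G0_gt0 => /size0nil ->.
  by rewrite nth_nil ltxx.
rewrite horner_coef (bigD1 (Ordinal size0)) //= expr0 mulr1 ltr_wpDr //.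
by apply: sumr_ge0 => k _; rewrite mulr_ge0 ?exprn_ge0 // ltW.
Qed.

Lemma lower_tail_asymptotic : exists eps : nat -> R,
  eps n @[n --> \oo] --> (0 : R) /\
  forall n M : nat, (0 < n)%N -> M%:R <= s * n%:R ->
    \sum_(m < M.+1) (G ^+ n)`_m <=
    Num.sqrt (chernoff_fun r / derive1n 2 chernoff_fun r) / ((1 - r) * r)
      * (chernoff_fun r ^+ n / Num.sqrt (2 * pi * n%:R)) * (1 + eps n).
Proof.
have tilt_coef k : (tilt G r)`_k = G`_k * r ^+ k / G.[r].
  by rewrite -[tilt G r]expr1 coef_tiltX !expr1.
have tilt_ge0 k : 0 <= (tilt G r)`_k.
  by rewrite tilt_coef divr_ge0 ?mulr_ge0 ?exprn_ge0 ?(ltW Gr_gt0) ?(ltW r0).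
have tilt_gt0 k : 0 < G`_k -> 0 < (tilt G r)`_k.
  by move=> Gk; rewrite tilt_coef divr_gt0 ?mulr_gt0 ?exprn_gt0.
have Gr_neq0 : G.[r] != 0 by rewrite gt_eqF.
have tilt1 := horner_tilt1 Gr_neq0.
have [tilt0_gt0 tilt1_gt0] := (tilt_gt0 _ G0_gt0, tilt_gt0 _ G1_gt0).
have var_gt0 := pgf_variance_gt0 tilt_ge0 tilt1 tilt0_gt0 tilt1_gt0.
exists (local_excess (tilt G r)); split; first exact: local_excess_cvg0.
move=> n M n0 leM.
have coef_le m := coefX_le_local_excess tilt_ge0 tilt1 tilt0_gt0 tilt1_gt0 m n0.
apply: le_trans (sum_coefX_le Gr_gt0 _ leM coef_le) _.
  by rewrite divr_ge0 ?addr_ge0 ?local_excess_ge0 ?mulr_ge0 ?sqrtr_ge0.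
have -> : Num.sqrt (chernoff_fun r / derive1n 2 chernoff_fun r) =
    r / Num.sqrt (pgf_variance (tilt G r)).
  rewrite chernoff_ratio // sqrtrM ?sqr_ge0 // sqrtr_sqr sqrtrV ?ltW //.
  by rewrite ger0_norm ?ltW.
rewrite !invfM.
move: (Num.sqrt _)^-1 (Num.sqrt _)^-1 => x y.
rewrite le_eqVlt; apply: predU1l; field.
by rewrite subr_eq0 !gt_eqF.
Qed.

End chernoff.

(** * Counting monomials of low degree *)

Lemma coef_polyX (R : comNzRingType) (q n m : nat) (c : nat -> R) :
  ((\poly_(i < q) c i) ^+ n)`_m =
  \sum_(e : {ffun 'I_n -> 'I_q} | (\sum_i e i == m)%N) \prod_i c (e i).
Proof.
rewrite poly_def -[in LHS](card_ord n) -prodr_const bigA_distr_bigA /= coef_sum.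
rewrite [RHS]big_mkcond; apply: eq_bigr => e _ /=.
under eq_bigr => i _ do rewrite -mul_polyC.
rewrite big_split /= prodrXr -rmorph_prod mul_polyC coefZ coefXn eq_sym.
by case: eqP; rewrite ?mulr1 ?mulr0.
Qed.

Lemma card_low_degree (R : comNzRingType) (n q : nat) :
  #|low_degree n q|%:R =
  \sum_(m < (q.-1 * n %/ 3).+1) ((\poly_(i < q) (1 : R)) ^+ n)`_m.
Proof.
set M := (_ %/ 3)%N.
pose total (e : {ffun 'I_n -> 'I_q}) : nat := (\sum_i e i)%N.
have lowE (e : {ffun 'I_n -> 'I_q}) : (e \in low_degree n q) = (total e <= M)%N.
  by rewrite inE leq_divRL // mulnC.
rewrite -sum1_card natr_sum (eq_bigl _ _ lowE).
rewrite (partition_big (fun e => inord (total e) : 'I_M.+1) xpredT) //=.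
apply: eq_bigr => m _; rewrite coef_polyX.
apply: eq_big => [e|e _]; last by rewrite prodr_const expr1n.
apply/andP/eqP => [[eM /eqP <-]|em]; first by rewrite inordK.
rewrite /total em -ltnS ltn_ord; split=> //.
by apply/eqP/val_inj; rewrite /= inordK.
Qed.

Lemma fq_chernoff (R : realType) (q : nat) :
  @fq R q = chernoff_fun (\poly_(i < q) 1) ((q%:R - 1) / 3).
Proof.
apply/funext => x; rewrite /fq /chernoff_fun powRN horner_poly; congr (_ / _).
by apply: eq_bigr => i _; rewrite mul1r.
Qed.

Lemma low_degree_asymptotic (R : realType) (q : nat) (r : R) :
  (1 < q)%N -> 0 < r -> r < 1 -> (forall x, 0 < x -> fq q r <= fq q x) ->
  exists eps : nat -> R, eps n @[n --> \oo] --> (0 : R) /\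
  forall n, (0 < n)%N -> #|low_degree n q|%:R <=
    Num.sqrt (fq q r / derive1n 2 (@fq R q) r) / ((1 - r) * r)
      * (fq q r ^+ n / Num.sqrt (2 * pi * n%:R)) * (1 + eps n).
Proof.
move=> q1 r0 r1; rewrite fq_chernoff => r_min.
have coefE k : (\poly_(i < q) (1 : R))`_k = (k < q)%:R.
  by rewrite coef_poly; case: ifP.
have coef_ge0 k : 0 <= (\poly_(i < q) (1 : R))`_k by rewrite coefE.
have coef_gt0 k : (k < q)%N -> 0 < (\poly_(i < q) (1 : R))`_k.
  by move=> kq; rewrite coefE kq.
have [eps [eps0 tail_le]] := lower_tail_asymptotic r0 r_min r1 coef_ge0
  (coef_gt0 _ (ltnW q1)) (coef_gt0 _ q1).
exists eps; split=> // n n0; rewrite card_low_degree.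
apply: tail_le => //.
have <- : q.-1%:R = q%:R - 1 :> R by rewrite -subn1 natrB // ltnW.
rewrite mulrAC ler_pdivlMr // -!natrM ler_nat.
exact: leq_trunc_div.
Qed.

Lemma fq_ge0 (R : realType) (q : nat) (x : R) : 0 < x -> 0 <= fq q x.
Proof.
move=> x0; rewrite divr_ge0 ?powR_ge0 // sumr_ge0 // => i _.
by rewrite exprn_ge0 // ltW.
Qed.

Lemma asymptotic_bound_le (R : realType) (K f : R) (eps : nat -> R) :
  0 <= K -> 0 <= f -> eps n @[n --> \oo] --> (0 : R) ->
  exists C, forall n : nat,
    K * (f ^+ n / Num.sqrt (2 * pi * n%:R)) * (1 + eps n) <=
    C * (f ^+ n / Num.sqrt n%:R).
Proof.
move=> K0 f0 /cvgP/cvg_seq_bounded[M [_ eps_le]].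
exists (K / Num.sqrt (2 * pi) * (1 + (M + 1))) => n.
have {}eps_le : 1 + eps n <= 1 + (M + 1).
  rewrite lerD2l (le_trans (ler_norm _)) //.
  by apply: (eps_le (M + 1)); rewrite ?ltrDl.
apply: le_trans (ler_wpM2l _ eps_le) _.
  by rewrite mulr_ge0 // mulr_ge0 ?invr_ge0 ?sqrtr_ge0 // exprn_ge0.
rewrite sqrtrM ?mulr_ge0 ?pi_ge0 // invfM le_eqVlt.
by apply: predU1l; ring.
Qed.

Lemma prime_power_gt1 (q : nat) : prime_power q -> (1 < q)%N.
Proof.
by case=> p [k [p_prime k0 ->]]; rewrite -(exp1n k) ltn_exp2r ?prime_gt1.
Qed.

Theorem theorem1p3 (R : realType) (q : nat) (hq : prime_power q)
    (r : R) (hr0 : 0 < r) (hr1 : r < 1)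
    (hmin : forall x : R, 0 < x -> fq q r <= fq q x) :
  (exists eps : nat -> R,
     (eps n @[n --> \oo] --> (0 : R)) /\
     (forall (F : finFieldType) (n : nat) (a b c : F) (A : {set 'rV[F]_n}),
        #|F| = q -> (0 < n)%N -> a + b + c = 0 -> c != 0 ->
        only_trivial_solutions a b c A ->
        #|A|%:R <= 3 / ((1 - r) * r) * Num.sqrt (fq q r / derive1n 2 (@fq R q) r)
                   * (fq q r ^+ n / Num.sqrt (2 * pi * n%:R)) * (1 + eps n)))
  /\
  (exists C : R,
     forall (F : finFieldType) (n : nat) (a b c : F) (A : {set 'rV[F]_n}),
       #|F| = q -> (0 < n)%N -> a + b + c = 0 -> c != 0 ->
       only_trivial_solutions a b c A ->
       #|A|%:R <= C * (fq q r ^+ n / Num.sqrt n%:R)).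
Proof.
have [eps [eps0 low_le]] :=
  low_degree_asymptotic (prime_power_gt1 hq) hr0 hr1 hmin.
set K := 3 / ((1 - r) * r) * Num.sqrt _.
have card_le (F : finFieldType) (n : nat) (a b c : F) (A : {set 'rV[F]_n}) :
    #|F| = q -> (0 < n)%N -> a + b + c = 0 -> c != 0 ->
    only_trivial_solutions a b c A -> #|A|%:R <=
    K * (fq q r ^+ n / Num.sqrt (2 * pi * n%:R)) * (1 + eps n).
  move=> cardF n0 abc _ /(card_le_low_degree abc); rewrite cardF -(ler_nat R).
  move/le_trans; apply; rewrite natrM.
  by apply: le_trans (ler_wpM2l _ (low_le n n0)) _; rewrite // /K; lra.
split; first by exists eps.
have K0 : 0 <= K.
  by rewrite !mulr_ge0 ?invr_ge0 ?mulr_ge0 ?sqrtr_ge0 ?subr_ge0 // ltW.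
have [C le_C] := asymptotic_bound_le K0 (fq_ge0 q hr0) eps0.
exists C => F n a b c A cardF n0 abc c0 trivA.
exact: le_trans (card_le F n a b c A cardF n0 abc c0 trivA) (le_C n).
Qed.
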